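(* For every $k\in\{1,\dots,m\}$ and every choice of row types $X,Y,Z\in\{\mathtt L,\mathtt R\}$ the following hold in $\mathcal F$ (indices $k+1$ are read cyclically, $c_{m+1}=c_1$). (RTT) For all horizontal spins $a,b,d,e$ and vertical spins $c,f\in\{\varnothing,c_k\}$: \[ \sum_{x,y,h} W^X_Y(a,b,x,y;z_1,z_2;k)\,T_X(x,c,d,h;z_1;k)\,T_Y(y,h,e,f;z_2;k) =\sum_{x,y,h} T_Y(b,c,x,h;z_2;k)\,T_X(a,h,y,f;z_1;k)\,W^X_Y(y,x,d,e;z_1,z_2;k+1), \] where $x,y$ range over horizontal spins and $h$ over $\{\varnothing,c_k\}$. (RRR) For all horizontal spins $a,b,c,d,e,f$: \[ \sum_{x,y,h} W^X_Y(a,b,x,y;z_1,z_2;k)\,W^X_Z(x,c,d,h;z_1,z_3;k)\,W^Y_Z(y,h,e,f;z_2,z_3;k) =\sum_{x,y,h} W^Y_Z(b,c,x,h;z_2,z_3;k)\,W^X_Z(a,h,y,f;z_1,z_3;k)\,W^X_Y(y,x,d,e;z_1,z_2;k), \] where $x,y,h$ range over horizontal spins.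
   Context: Fix $m\ge1$, palette $\mathcal P=\{c_1<\dots<c_m\}$. Work in a field $\mathcal F$ containing indeterminates $q,\Phi,z_1,z_2,z_3$ and elements $\mathfrak X_{i,j}$ ($1\le i,j\le m$) with $\mathfrak X_{i,i}=-q^2$, $\mathfrak X_{i,j}\mathfrak X_{j,i}=q^2$ ($i\ne j$). A horizontal spin is $\varnothing$ or a colour in $\mathcal P$. $T$-vertices: $T_X(\alpha,\beta,\gamma,\delta;z;k)$ is the weight of a vertex of column colour $c_k$, row parameter $z$, with left, top, right, bottom spins $\alpha,\beta,\gamma,\delta$ (left/right horizontal, top/bottom in $\{\varnothing,c_k\}$). $T_{\mathtt R}$ (unlisted $=0$): $(\varnothing,\varnothing,\varnothing,\varnothing)\mapsto1$; $(c_i,c_k,c_i,c_k)\mapsto\Phi\mathfrak X_{i,k}(z$ if $i=k$, else $1)$; $(\varnothing,c_k,\varnothing,c_k)\mapsto\Phi$; $(c_i,\varnothing,c_i,\varnothing)\mapsto(z$ if $i=k$, else $1)$; $(c_k,\varnothing,\varnothing,c_k)\mapsto\Phi(1-q^2)z$; $(\varnothing,c_k,c_k,\varnothing)\mapsto1$. $T_{\mathtt L}$ (unlisted $=0$): $(\varnothing,\varnothing,\varnothing,\varnothing)\mapsto1$; $(c_i,c_k,c_i,c_k)\mapsto\Phi\mathfrak X_{k,i}(z^{-1}$ if $i=k$, else $1)$; $(\varnothing,c_k,\varnothing,c_k)\mapsto\Phi$; $(c_i,\varnothing,c_i,\varnothing)\mapsto(z^{-1}$ if $i=k$, else $1)$;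 $(\varnothing,\varnothing,c_k,c_k)\mapsto\Phi(1-q^2)$; $(c_k,c_k,\varnothing,\varnothing)\mapsto z^{-1}$. $R$-vertices: $W^X_Y(a,b,c,d;u,w;k)$ is the weight of an $R$-vertex of colour $c_k$ with bottom-left, top-left, top-right, bottom-right spins $a,b,c,d$ (all horizontal spins); $u$ is the parameter of the line from bottom-left to top-right and $w$ that of the line from top-left to bottom-right. For colours write $A=A(i,j,k)$: ''$i<j<k$ or $j<k\le i$ or $k\le i<j$'', and $B=B(i,j,k)$: ''$j<i<k$ or $i<k\le j$ or $k\le j<i$''. For integers $x$ let $\mathrm{res}_m(x)\in\{0,\dots,m-1\}$ and $\mathrm{res}^m(x)\in\{1,\dots,m\}$ be the residues congruent to $x$ mod $m$. Configurations (always $i\ne j$ where both appear): (1) $(\varnothing,\varnothing,\varnothing,\varnothing)$; (2) $(c_i,\varnothing,c_i,\varnothing)$; (3) $(\varnothing,c_i,\varnothing,c_i)$; (4) $(c_i,c_i,c_i,c_i)$; (5) $(c_i,c_j,c_i,c_j)$; (6) $(\varnothing,c_i,c_i,\varnothing)$; (7) $(c_i,\varnothing,\varnothing,c_i)$; (8) $(c_i,c_j,c_j,c_i)$; (9) $(\varnothing,\varnothing,c_i,c_i)$; (10) $(c_i,c_i,\varnothing,\varnothing)$; (11) $(c_i,c_i,c_j,c_j)$. All configurations not listed for a given type have weight $0$. $W^{\mathtt L}_{\mathtt L}$: (1) $u-q^2w$; (2) $q^2\Phi(u-w)$; (3) $(u-w)/\Phi$; (4) $w-q^2u$; (5) $\mathfrak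 X_{i,j}(u-w)$; (6) $(1-q^2)u$; (7) $(1-q^2)w$; (8) $(1-q^2)w$ if $A$, $(1-q^2)u$ if $B$. $W^{\mathtt R}_{\mathtt R}$: (1) $u-q^2w$; (2) $(u-w)/\Phi$; (3) $q^2\Phi(u-w)$; (4) $w-q^2u$; (5) $\mathfrak X_{i,j}(u-w)$; (6) $(1-q^2)w$; (7) $(1-q^2)u$; (8) $(1-q^2)u$ if $A$, $(1-q^2)w$ if $B$. $W^{\mathtt L}_{\mathtt R}$: (1) $u-w$; (2),(3) $\Phi(u-q^2w)$; (4) $\Phi^2(q^4w-u)$; (5) $\Phi^2\mathfrak X_{j,i}(u-q^2w)$; (9) $\Phi(1-q^2)u$; (10) $\Phi(1-q^2)w$; (11) $-\Phi^2(1-q^2)q^2w$ if $A$, $-\Phi^2(1-q^2)u$ if $B$. $W^{\mathtt R}_{\mathtt L}$: (1) $w-q^{2m+2}u$; (2),(3) $(w-q^{2m}u)/\Phi$; (4) $(q^{2m-2}u-w)/\Phi^2$; (5) $\mathfrak X_{j,i}(w-q^{2m}u)/(q^2\Phi^2)$; (9) $q^{2\mathrm{res}^m(k-i)-2}(1-q^2)w/\Phi$; (10) $q^{2\mathrm{res}_m(i-k)}(1-q^2)u/\Phi$; (11) $q^{2\mathrm{res}_m(i-j)-2}(1-q^2)u/\Phi^2$ if $A$, $q^{2\mathrm{res}_m(i-j)-2}(1-q^2)w/\Phi^2$ if $B$. *)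

(* Defs.v *)
From mathcomp Require Import all_boot all_order all_algebra.
From mathcomp Require Import mpoly.

Set Implicit Arguments.
Unset Strict Implicit.
Unset Printing Implicit Defensive.

Import Order.TTheory GRing.Theory Num.Theory.
Local Open Scope ring_scope.

(* Algebraic independence over the prime subfield of F, in any characteristic:
   the polynomials over the prime subfield are exactly the images of the
   integer polynomials. *)
Definition alg_independent (F : fieldType) (n : nat) (v : n.-tuple F) : Prop :=
  forall p : {mpoly int[n]},
    (map_mpoly (intr : int -> F) p).@[tnth v] = 0 ->
    map_mpoly (intr : int -> F) p = 0.

Inductive rowtype := L | R.

(* The colours c_1 < ... < c_m are the elements 0 < ... < m-1 of 'I_m, so that
   the cyclic successor of c_k is [ordS k].  None is the empty spin. *)
Notation spin m := (option 'I_m).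

Definition vertical (m : nat) (k : 'I_m) (s : spin m) : bool :=
  (s == None) || (s == Some k).

Section Weights.

Context (F : fieldType) (m : nat).
Implicit Types (q Phi z u w : F) (X : 'I_m -> 'I_m -> F) (i j k : 'I_m).

(* Spins are listed as left, top, right, bottom. *)
Definition T_R q Phi X (al be ga de : spin m) z k : F :=
  match al, be, ga, de with
  | None, None, None, None => 1
  | Some i, Some b, Some c, Some d =>
      if [&& b == k, c == i & d == k]
      then Phi * X i k * (if i == k then z else 1) else 0
  | None, Some b, None, Some d => if (b == k) && (d == k) then Phi else 0
  | Some i, None, Some c, None =>
      if c == i then (if i == k then z else 1) else 0
  | Some a, None, None, Some d =>
      if (a == k) && (d == k) then Phi * (1 - q ^+ 2) * z else 0
  | None, Some b, Some c, None => if (b == k) && (c == k) then 1 else 0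
  | _, _, _, _ => 0
  end.

Definition T_L q Phi X (al be ga de : spin m) z k : F :=
  match al, be, ga, de with
  | None, None, None, None => 1
  | Some i, Some b, Some c, Some d =>
      if [&& b == k, c == i & d == k]
      then Phi * X k i * (if i == k then z^-1 else 1) else 0
  | None, Some b, None, Some d => if (b == k) && (d == k) then Phi else 0
  | Some i, None, Some c, None =>
      if c == i then (if i == k then z^-1 else 1) else 0
  | None, None, Some c, Some d =>
      if (c == k) && (d == k) then Phi * (1 - q ^+ 2) else 0
  | Some a, Some b, None, None => if (a == k) && (b == k) then z^-1 else 0
  | _, _, _, _ => 0
  end.

Definition T q Phi X (t : rowtype) :=
  match t with L => T_L q Phi X | R => T_R q Phi X end.

Definition condA i j k : bool :=
  [|| (i < j < k)%N, (j < k <= i)%N | (k <= i < j)%N].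

Definition condB i j k : bool :=
  [|| (j < i < k)%N, (i < k <= j)%N | (k <= j < i)%N].

(* For i != j exactly one of A and B holds, so the last 0 is never reached. *)
Definition ifAB i j k (x y : F) : F :=
  if condA i j k then x else if condB i j k then y else 0.

(* res_m, with values in {0, ..., m-1}, and res^m, with values in {1, ..., m} *)
Definition res_lo (x : int) : int := (x %% m%:Z)%Z.
Definition res_up (x : int) : int := if res_lo x == 0 then m%:Z else res_lo x.

(* Spins of R-vertices are listed as bottom-left, top-left, top-right,
   bottom-right. *)
Definition W_LL q Phi X (a b c d : spin m) u w k : F :=
  match a, b, c, d with
  | None, None, None, None => u - q ^+ 2 * w
  | Some i, None, Some i', None =>
      if i' == i then q ^+ 2 * Phi * (u - w) else 0
  | None, Some i, None, Some i' => if i' == i then (u - w) / Phi else 0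
  | None, Some i, Some i', None => if i' == i then (1 - q ^+ 2) * u else 0
  | Some i, None, None, Some i' => if i' == i then (1 - q ^+ 2) * w else 0
  | Some i, Some j, Some i', Some j' =>
      if (i' == i) && (j' == j) then
        if i == j then w - q ^+ 2 * u else X i j * (u - w)
      else if (i' == j) && (j' == i) then
        ifAB i j k ((1 - q ^+ 2) * w) ((1 - q ^+ 2) * u)
      else 0
  | _, _, _, _ => 0
  end.

Definition W_RR q Phi X (a b c d : spin m) u w k : F :=
  match a, b, c, d with
  | None, None, None, None => u - q ^+ 2 * w
  | Some i, None, Some i', None => if i' == i then (u - w) / Phi else 0
  | None, Some i, None, Some i' =>
      if i' == i then q ^+ 2 * Phi * (u - w) else 0
  | None, Some i, Some i', None => if i' == i then (1 - q ^+ 2) * w else 0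
  | Some i, None, None, Some i' => if i' == i then (1 - q ^+ 2) * u else 0
  | Some i, Some j, Some i', Some j' =>
      if (i' == i) && (j' == j) then
        if i == j then w - q ^+ 2 * u else X i j * (u - w)
      else if (i' == j) && (j' == i) then
        ifAB i j k ((1 - q ^+ 2) * u) ((1 - q ^+ 2) * w)
      else 0
  | _, _, _, _ => 0
  end.

Definition W_LR q Phi X (a b c d : spin m) u w k : F :=
  match a, b, c, d with
  | None, None, None, None => u - w
  | Some i, None, Some i', None =>
      if i' == i then Phi * (u - q ^+ 2 * w) else 0
  | None, Some i, None, Some i' =>
      if i' == i then Phi * (u - q ^+ 2 * w) else 0
  | None, None, Some i, Some i' =>
      if i' == i then Phi * (1 - q ^+ 2) * u else 0
  | Some i, Some i', None, None =>
      if i' == i then Phi * (1 - q ^+ 2) * w else 0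
  | Some i, Some j, Some i', Some j' =>
      if (i' == i) && (j' == j) then
        if i == j then Phi ^+ 2 * (q ^+ 4 * w - u)
        else Phi ^+ 2 * X j i * (u - q ^+ 2 * w)
      else if (j == i) && (j' == i') then
        ifAB i i' k (- Phi ^+ 2 * (1 - q ^+ 2) * q ^+ 2 * w)
                    (- Phi ^+ 2 * (1 - q ^+ 2) * u)
      else 0
  | _, _, _, _ => 0
  end.

Definition W_RL q Phi X (a b c d : spin m) u w k : F :=
  match a, b, c, d with
  | None, None, None, None => w - q ^ (2 * m%:Z + 2) * u
  | Some i, None, Some i', None =>
      if i' == i then (w - q ^ (2 * m%:Z) * u) / Phi else 0
  | None, Some i, None, Some i' =>
      if i' == i then (w - q ^ (2 * m%:Z) * u) / Phi else 0
  | None, None, Some i, Some i' =>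
      if i' == i then
        q ^ (2 * res_up (k%:Z - i%:Z) - 2) * (1 - q ^+ 2) * w / Phi
      else 0
  | Some i, Some i', None, None =>
      if i' == i then
        q ^ (2 * res_lo (i%:Z - k%:Z)) * (1 - q ^+ 2) * u / Phi
      else 0
  | Some i, Some j, Some i', Some j' =>
      if (i' == i) && (j' == j) then
        if i == j then (q ^ (2 * m%:Z - 2) * u - w) / Phi ^+ 2
        else X j i * (w - q ^ (2 * m%:Z) * u) / (q ^+ 2 * Phi ^+ 2)
      else if (j == i) && (j' == i') then
        ifAB i i' k
          (q ^ (2 * res_lo (i%:Z - i'%:Z) - 2) * (1 - q ^+ 2) * u / Phi ^+ 2)
          (q ^ (2 * res_lo (i%:Z - i'%:Z) - 2) * (1 - q ^+ 2) * w / Phi ^+ 2)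
      else 0
  | _, _, _, _ => 0
  end.

(* [W q Phi X t s] is W^t_s: t is the type of the line carrying u, s that of
   the line carrying w. *)
Definition W q Phi X (t s : rowtype) :=
  match t, s with
  | L, L => W_LL q Phi X
  | R, R => W_RR q Phi X
  | L, R => W_LR q Phi X
  | R, L => W_RL q Phi X
  end.

End Weights.

(* Main.v *)
(** The weights LL, RR and T_R are of exchange type: the two incoming spins
    either go straight or are swapped.  The weights LR and T_L become of this
    type once one of the two lines is read backwards.  In the equations LLL,
    RRR, LLR, LRR (and the RTT equations LL, RR, LR) the lines can be oriented
    so that there is no closed loop, and both sides are sums of eight terms
    which are compared case by case.

    The other equations, some of which contain a sum over the colour of a closed
    loop, are deduced from these: W^L_R(u, w) and W^R_L(w, u) are inverse to
    each other up to the scalar (u - q^2 w)(u - q^(2m) w), and multiplying an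
    equation on both sides by the inverse of a crossing interchanges the two
    lines which cross.  The scalar is nonzero by algebraic independence, and the
    inversion only needs geometric sums, because the conditions A and B compare
    the places of two colours in the cyclic order starting at c_k. *)
Require Import Defs.
From HB Require Import structures.
From mathcomp Require Import all_boot all_order all_algebra.
From mathcomp Require Import mpoly.
From mathcomp Require Import zify ring.

Set Implicit Arguments.
Unset Strict Implicit.
Unset Printing Implicit Defensive.

Import Order.TTheory GRing.Theory Num.Theory.
Local Open Scope ring_scope.

(** * Yang-Baxter equation for general kernels *)

Section YangBaxter.

Context (F : fieldType) (S : finType).
Implicit Types (V : S -> S -> S -> S -> F) (al be : S -> S -> F).

Definition ybe V12 V13 V23 V12' V13' V23' : Prop :=
  forall a b c d e f : S,
    \sum_x \sum_y \sum_h V12 a b x y * V13 x c d h * V23 y h e f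
    = \sum_x \sum_y \sum_h V23' b c x h * V13' a h y f * V12' y x d e.

(* The same kernel with the two lines interchanged, with the line from top-left
   to bottom-right read backwards, and with the other line read backwards. *)
Definition flip V p q r s := V q p s r.
Definition rot_r V p q r s := V p s r q.
Definition rot_l V p q r s := V r q p s.

Lemma ybe_rot_r V12 V13 V23 V12' V13' V23' :
  ybe (flip V12) (rot_r V23) (rot_r V13)
      (flip V12') (rot_r V23') (rot_r V13') ->
  ybe V12 V13 V23 V12' V13' V23'.
Proof.
move=> Y a b c d e f; rewrite exchange_big /=.
transitivity (\sum_x \sum_y \sum_h flip V12 b a x y * rot_r V23 x f e h
                * rot_r V13 y h d c).
  by do 3!apply: eq_bigr => ? _; rewrite mulrAC.
rewrite Y exchange_big.
by do 3!apply: eq_bigr => ? _; rewrite [rot_r V13' _ _ _ _ * _]mulrC.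
Qed.

Lemma ybe_rot_l V12 V13 V23 V12' V13' V23' :
  ybe (rot_l V13) (rot_l V12) (flip V23)
      (rot_l V13') (rot_l V12') (flip V23') ->
  ybe V12 V13 V23 V12' V13' V23'.
Proof.
move=> Y a b c d e f.
transitivity (\sum_x \sum_y \sum_h rot_l V13 d c x y * rot_l V12 x b a h
                * flip V23 y h f e).
  apply: eq_bigr => x _; rewrite exchange_big /=.
  by do 2!apply: eq_bigr => ? _; rewrite [rot_l V13 _ _ _ _ * _]mulrC.
rewrite Y.
transitivity (\sum_h \sum_y \sum_x V23' b c x h * V13' a h y f
                * V12' y x d e).
  by do 3!apply: eq_bigr => ? _; rewrite mulrAC.
rewrite exchange_big [RHS]exchange_big /=; apply: eq_bigr => y _.
by rewrite exchange_big.
Qed.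

(** * Kernels of exchange type *)

Definition exch al be (a b c d : S) : F :=
  al a b * (c == a)%:R * (d == b)%:R + be a b * (c == b)%:R * (d == a)%:R.

Lemma sum_pred1 (f : S -> F) (a : S) : \sum_x (x == a)%:R * f x = f a.
Proof.
rewrite (bigD1 a) //= eqxx mul1r big1 ?addr0 // => x /negbTE->.
by rewrite mul0r.
Qed.

Lemma sum_exch al be a b (f : S -> S -> F) :
  \sum_x \sum_y exch al be a b x y * f x y
  = al a b * f a b + be a b * f b a.
Proof.
under eq_bigr => x _.
  under eq_bigr => y _ do rewrite mulrDl.
  rewrite big_split /=.
  under eq_bigr => y _ do rewrite -mulrA.
  rewrite -mulr_sumr sum_pred1.
  under [X in _ + X]eq_bigr => y _ do rewrite -mulrA.
  rewrite -mulr_sumr sum_pred1 -!mulrA.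
  over.
by rewrite big_split /= -!mulr_sumr !sum_pred1.
Qed.

Lemma sum_exch_last al be a b c (f : S -> F) :
  \sum_h exch al be a b c h * f h
  = al a b * (c == a)%:R * f b + be a b * (c == b)%:R * f a.
Proof.
under eq_bigr => h _ do rewrite mulrDl -!mulrA.
by rewrite big_split /= -!mulr_sumr !sum_pred1 !mulrA.
Qed.

Lemma sum_exch_third al be a b d (f : S -> F) :
  \sum_h exch al be a b h d * f h
  = al a b * (d == b)%:R * f a + be a b * (d == a)%:R * f b.
Proof.
under eq_bigr => h _ do
  rewrite mulrDl [al a b * _ * _]mulrAC [be a b * _ * _]mulrAC -!mulrA.
by rewrite big_split /= -!mulr_sumr !sum_pred1 !mulrA.
Qed.

Lemma exch_ybe a1 b1 a2 b2 a3 b3 a1' b1' a2' b2' a3' b3' :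
  (forall (a b c : S) (phi : S -> S -> S -> F),
    a1 a b * (a2 a c * (a3 b c * phi a b c + b3 b c * phi a c b)
              + b2 a c * (a3 b a * phi c b a + b3 b a * phi c a b))
    + b1 a b * (a2 b c * (a3 a c * phi b a c + b3 a c * phi b c a)
                + b2 b c * (a3 a b * phi c a b + b3 a b * phi c b a))
    = a3' b c * (a2' a c * (a1' a b * phi a b c + b1' a b * phi b a c)
                 + b2' a c * (a1' c b * phi c b a + b1' c b * phi b c a))
    + b3' b c * (a2' a b * (a1' a c * phi a c b + b1' a c * phi c a b)
                 + b2' a b * (a1' b c * phi b c a + b1' b c * phi c b a))) ->
  ybe (exch a1 b1) (exch a2 b2) (exch a3 b3)
      (exch a1' b1') (exch a2' b2') (exch a3' b3').
Proof.
move=> E a b c d e f.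
transitivity (\sum_x \sum_y exch a1 b1 a b x y *
               \sum_h exch a2 b2 x c d h * exch a3 b3 y h e f).
  do 2!apply: eq_bigr => ? _; rewrite mulr_sumr.
  by apply: eq_bigr => ? _; rewrite mulrA.
rewrite sum_exch !sum_exch_last.
transitivity (\sum_x \sum_h exch a3' b3' b c x h *
               \sum_y exch a2' b2' a h y f * exch a1' b1' y x d e); last first.
  apply: eq_bigr => x _; rewrite [RHS]exchange_big; apply: eq_bigr => h _.
  by rewrite mulr_sumr; apply: eq_bigr => ? _; rewrite mulrA.
rewrite sum_exch !sum_exch_third.
(* [phi] is the indicator of the outgoing triple [d], [e], [f]. *)
have := E a b c (fun x y z => (d == x)%:R * (e == y)%:R * (f == z)%:R).
rewrite /exch => {}E.
apply: (etrans _ (etrans E _)) => {E}.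
  move: (d == a)%:R (d == b)%:R (d == c)%:R (e == a)%:R (e == b)%:R.
  by move: (e == c)%:R (f == a)%:R (f == b)%:R (f == c)%:R => *; ring.
move: (d == a)%:R (d == b)%:R (d == c)%:R (e == a)%:R (e == b)%:R.
by move: (e == c)%:R (f == a)%:R (f == b)%:R (f == c)%:R => *; ring.
Qed.

(* States list the spins of the three lines from bottom to top; [braid1] crosses
   the two lower lines and [braid2] the two upper ones, and the
   spins x (top right) and y (bottom right) leave in the order y, x. *)
Definition state := {ffun S * S * S -> F^o}.

Definition braid1 V (phi : state) : state :=
  [ffun s => \sum_x \sum_y V s.1.1 s.1.2 x y * phi (y, x, s.2)].
Definition braid2 V (phi : state) : state :=
  [ffun s => \sum_x \sum_y V s.1.2 s.2 x y * phi (s.1.1, y, x)].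

Lemma braid1_linear V : linear (braid1 V).
Proof.
move=> k phi psi; apply/ffunP => s; rewrite !ffunE /=.
rewrite scaler_sumr -big_split; apply: eq_bigr => x _ /=.
rewrite scaler_sumr -big_split; apply: eq_bigr => y _ /=.
by rewrite !ffunE /= mulrDr /GRing.scale /= mulrCA.
Qed.

Lemma braid2_linear V : linear (braid2 V).
Proof.
move=> k phi psi; apply/ffunP => s; rewrite !ffunE /=.
rewrite scaler_sumr -big_split; apply: eq_bigr => x _ /=.
rewrite scaler_sumr -big_split; apply: eq_bigr => y _ /=.
by rewrite !ffunE /= mulrDr /GRing.scale /= mulrCA.
Qed.

HB.instance Definition _ V :=
  GRing.isLinear.Build F state state *:%R (braid1 V) (braid1_linear V).
HB.instance Definition _ V :=
  GRing.isLinear.Build F state state *:%R (braid2 V) (braid2_linear V).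

Definition delta (t : S * S * S) : state := [ffun s => (s == t)%:R].

Lemma state_delta (phi : state) : phi = \sum_t phi t *: delta t.
Proof.
apply/ffunP => s; rewrite sum_ffunE (bigD1 s) //= big1 => [|t /negbTE st].
  by rewrite !ffunE eqxx addr0 /GRing.scale /= mulr1.
by rewrite !ffunE eq_sym st scaler0.
Qed.

Lemma braid1_delta V a b c d e f :
  braid1 V (delta (f, e, d)) (a, b, c) = (c == d)%:R * V a b e f.
Proof.
rewrite ffunE /= -(sum_pred1 (fun x => _ * V a b x f)).
apply: eq_bigr => x _.
rewrite -(sum_pred1 (fun y => _ * V a b x y)) mulr_sumr.
apply: eq_bigr => y _; rewrite ffunE !xpair_eqE -!mulnb !natrM.
by move: (y == f)%:R (x == e)%:R (c == d)%:R => /= *; ring.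
Qed.

Lemma braid2_delta V a b c d e f :
  braid2 V (delta (f, e, d)) (a, b, c) = (a == f)%:R * V b c d e.
Proof.
rewrite ffunE /= -(sum_pred1 (fun x => _ * V b c x e)).
apply: eq_bigr => x _.
rewrite -(sum_pred1 (fun y => _ * V b c x y)) mulr_sumr.
apply: eq_bigr => y _; rewrite ffunE !xpair_eqE -!mulnb !natrM.
by move: (y == e)%:R (x == d)%:R (a == f)%:R => /= *; ring.
Qed.

(** The two sides of [ybe] are the entries of the two composites in the basis [delta]; linearity
    extends the equality to all states. *)
Lemma ybeP V12 V13 V23 V12' V13' V23' :
  ybe V12 V13 V23 V12' V13' V23' <->
  forall phi, braid1 V12 (braid2 V13 (braid1 V23 phi))
              = braid2 V23' (braid1 V13' (braid2 V12' phi)).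
Proof.
have lhsE a b c d e f :
    braid1 V12 (braid2 V13 (braid1 V23 (delta (f, e, d)))) (a, b, c)
    = \sum_x \sum_y \sum_h V12 a b x y * V13 x c d h * V23 y h e f.
  rewrite ffunE /=; apply: eq_bigr => x _; apply: eq_bigr => y _.
  rewrite ffunE /= exchange_big /= mulr_sumr; apply: eq_bigr => h _.
  rewrite -mulrA; congr (_ * _).
  rewrite -(sum_pred1 (fun d => V13 x c d h * _)); apply: eq_bigr => d' _.
  by rewrite braid1_delta mulrCA.
have rhsE a b c d e f :
    braid2 V23' (braid1 V13' (braid2 V12' (delta (f, e, d)))) (a, b, c)
    = \sum_x \sum_y \sum_h V23' b c x h * V13' a h y f * V12' y x d e.
  rewrite ffunE /=; apply: eq_bigr => x _; rewrite [RHS]exchange_big /=.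
  apply: eq_bigr => h _; rewrite ffunE /= mulr_sumr; apply: eq_bigr => y _.
  rewrite -mulrA; congr (_ * _).
  rewrite -(sum_pred1 (fun f => V13' a h y f * _)); apply: eq_bigr => f' _.
  by rewrite braid2_delta mulrCA.
split=> [Y phi | Y a b c d e f]; last by rewrite -lhsE -rhsE Y.
rewrite (state_delta phi) !linear_sum; apply: eq_bigr => -[[f e] d] _.
rewrite !linearZ; congr (_ *: _).
by apply/ffunP => -[[a b] c]; rewrite lhsE rhsE.
Qed.

(** The spins [y], [x] enter [U] in this order because the bottom-right spin of the first crossing
    is the bottom-left spin of the second. *)
Definition unitarity kappa V U : Prop := forall a b c d : S,
  \sum_x \sum_y V a b x y * U y x c d = kappa * (c == b)%:R * (d == a)%:R.

(** Kernels are square matrices indexed by pairs of spins, and a right inverse of a square matrix is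
    also a left inverse. *)
Lemma unitarity_sym kappa V U :
  kappa != 0 -> unitarity kappa V U -> unitarity kappa U V.
Proof.
move=> k0 VU.
pose mx (W : S -> S -> S -> S -> F) : 'M[F]_#|{: S * S}| :=
  \matrix_(i, j) W (enum_val i).1 (enum_val i).2
                   (enum_val j).2 (enum_val j).1.
have mulE V1 V2 i j : (mx V1 *m mx V2) i j =
    \sum_x \sum_y V1 (enum_val i).1 (enum_val i).2 x y
      * V2 y x (enum_val j).2 (enum_val j).1.
  rewrite exchange_big pair_big /= !mxE.
  rewrite [RHS](reindex (@enum_val _ {: S * S})) /=; last first.
    by exists enum_rank => ? _; rewrite ?enum_valK ?enum_rankK.
  by apply: eq_bigr => u _; rewrite !mxE.
have VU1 : mx V *m (kappa^-1 *: mx U) = 1%:M.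
  apply/matrixP => i j; rewrite -scalemxAr !mxE.
  have := mulE V U i j; rewrite mxE => ->; rewrite VU.
  rewrite -mulrA -natrM mulnb mulKf // eq_sym [X in _ && X]eq_sym andbC.
  by rewrite -xpair_eqE -!surjective_pairing (inj_eq enum_val_inj).
move/mulmx1C: VU1 => UV1 a b c d.
have := mulE U V (enum_rank (a, b)) (enum_rank (d, c)).
rewrite !enum_rankK /= => <-.
rewrite -[mx U](scalerKV k0) -scalemxAl UV1 !mxE (inj_eq enum_rank_inj).
rewrite xpair_eqE -mulnb natrM mulrA [a == d]eq_sym [b == c]eq_sym.
by rewrite mulrAC.
Qed.

Lemma braid1_unitarity kappa V U phi :
  unitarity kappa V U -> braid1 V (braid1 U phi) = kappa *: phi.
Proof.
move=> VU; rewrite (state_delta phi) !linear_sum; apply: eq_bigr.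
move=> -[[f e] d] _; rewrite !linearZ /=.
congr (_ *: _). apply/ffunP => -[[a b] c]; rewrite !ffunE /=.
transitivity ((c == d)%:R * \sum_x \sum_y V a b x y * U y x e f).
  rewrite mulr_sumr; apply: eq_bigr => x _.
  rewrite mulr_sumr; apply: eq_bigr => y _.
  by rewrite braid1_delta mulrCA.
rewrite VU !xpair_eqE -!mulnb !natrM /GRing.scale /=.
rewrite [a == f]eq_sym [b == e]eq_sym.
by move: (c == d)%:R (e == b)%:R (f == a)%:R => *; ring.
Qed.

Lemma braid2_unitarity kappa V U phi :
  unitarity kappa V U -> braid2 V (braid2 U phi) = kappa *: phi.
Proof.
move=> VU; rewrite (state_delta phi) !linear_sum; apply: eq_bigr.
move=> -[[f e] d] _; rewrite !linearZ /=.
congr (_ *: _); apply/ffunP => -[[a b] c]; rewrite !ffunE /=.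
transitivity ((a == f)%:R * \sum_x \sum_y V b c x y * U y x d e).
  rewrite mulr_sumr; apply: eq_bigr => x _.
  rewrite mulr_sumr; apply: eq_bigr => y _.
  by rewrite braid2_delta mulrCA.
rewrite VU !xpair_eqE -!mulnb !natrM /GRing.scale /=.
rewrite [c == d]eq_sym [b == e]eq_sym.
by move: (d == c)%:R (e == b)%:R (a == f)%:R => *; ring.
Qed.

(* Multiplying on both sides by the inverse of the crossing of lines 1 and 2
   interchanges these two lines. *)
Lemma ybe_swap12 kappa V12 V13 V23 V12' V13' V23' V21 V21' :
  kappa != 0 -> unitarity kappa V21 V12 -> unitarity kappa V12' V21' ->
  ybe V12 V13 V23 V12' V13' V23' -> ybe V21 V23' V13' V21' V23 V13.
Proof.
move=> k0 U U' /ybeP Y; apply/ybeP => phi; apply: (scalerI k0).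
by rewrite -[RHS](braid1_unitarity _ U) Y (braid2_unitarity _ U') !linearZ.
Qed.

Lemma ybe_swap23 kappa V12 V13 V23 V12' V13' V23' V32 V32' :
  kappa != 0 -> unitarity kappa V23 V32 -> unitarity kappa V32' V23' ->
  ybe V12 V13 V23 V12' V13' V23' -> ybe V13' V12' V32 V13 V12 V32'.
Proof.
move=> k0 U U' /ybeP Y; apply/ybeP => phi; apply: (scalerI k0).
by rewrite -[LHS](braid2_unitarity _ U') -Y (braid1_unitarity _ U) !linearZ.
Qed.

End YangBaxter.

(** * Cyclic order of the colours *)

Section Position.

Context (m : nat).
Implicit Types (i j k : 'I_m).

(* The place of a colour in the list c_k, c_(k+1), ..., c_(k-1); the empty spin
   comes last. *)
Definition pos k (s : spin m) : nat :=
  if s is Some i then if (k <= i)%N then (i - k)%N else (i + m - k)%N else m.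

Lemma ltn_pos k i : (pos k (Some i) < m)%N.
Proof.
by rewrite /pos; have := ltn_ord i; have := ltn_ord k; case: ifP; lia.
Qed.

Lemma pos_inj k : injective (pos k).
Proof.
move=> [i|] [j|] //= E.
- congr Some; apply: val_inj => /=; move: E.
  have := ltn_ord i; have := ltn_ord j; have := ltn_ord k.
  by do 2!case: ifP; lia.
- by have := ltn_pos k i; rewrite /= E ltnn.
- by have := ltn_pos k j; rewrite /= -E ltnn.
Qed.

(** Cut the cyclic order just before [k]: either both colours lie on the same side of the cut, or
    [i] is at or after [k] and [j] before it. These are the three alternatives of [condA]. *)
Lemma condAE i j k : condA i j k = (pos k (Some i) < pos k (Some j))%N.
Proof.
rewrite /condA /=; have := ltn_ord i; have := ltn_ord j; have := ltn_ord k.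
by do 2!case: ifP; lia.
Qed.

Lemma condBE i j k : condB i j k = (pos k (Some j) < pos k (Some i))%N.
Proof.
rewrite /condB /=; have := ltn_ord i; have := ltn_ord j; have := ltn_ord k.
by do 2!case: ifP; lia.
Qed.

Lemma pos_self k : pos k (Some k) = 0%N.
Proof. by rewrite /= leqnn subnn. Qed.

Lemma pos_ordS_self k : pos (ordS k) (Some k) = m.-1.
Proof.
rewrite /=; case: (ltngtP k.+1 m) (ltn_ord k) => // [km|km] _.
  by rewrite modn_small // ltnn; lia.
by rewrite [in (_ %% m)%N]km modnn leq0n; lia.
Qed.

Lemma pos_ordS k i : i != k -> pos (ordS k) (Some i) = (pos k (Some i)).-1.
Proof.
move=> /eqP ik; have {}ik : nat_of_ord i <> k by move/val_inj.
rewrite /=; have := ltn_ord k; have := ltn_ord i.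
case: (ltngtP k.+1 m) => // [km|km] im _.
  by rewrite modn_small //; do 2!case: ifP; lia.
by rewrite [in (_ %% m)%N]km modnn leq0n; case: ifP; lia.
Qed.

Lemma pos_empty k : pos k None = m.
Proof. by []. Qed.

End Position.

Arguments pos : simpl never.

(** * Residues of differences of colours *)

Section Residues.

Context (m : nat).
Implicit Types (i j k : 'I_m).

Lemma res_lo_unique (x c r : int) :
  x = r + c * m%:Z -> 0 <= r < m%:Z -> res_lo m x = r.
Proof. by move=> -> rm; rewrite /res_lo addrC modzMDl modz_small. Qed.

Lemma res_lo_pos i j k : res_lo m (i%:Z - j%:Z) =
  if (pos k (Some j) <= pos k (Some i))%N
  then (pos k (Some i))%:Z - (pos k (Some j))%:Z
  else (pos k (Some i) + m)%:Z - (pos k (Some j))%:Z.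
Proof.
have := ltn_ord i; have := ltn_ord j; have := ltn_ord k.
have := ltn_pos k i; have := ltn_pos k j; rewrite /pos => pj pi km jm im.
(* A place is the colour minus [k], plus [m] if the colour is below [k]. This gives the first two
   terms of the quotient; the last corrects a negative difference of places. *)
apply: (@res_lo_unique _ ((i < k)%N%:Z * -1 + (j < k)%N%:Z
   - (~~ (pos k (Some j) <= pos k (Some i))%N)%:Z)); rewrite /pos.
all: move: pi pj; case: (leqP k i) => ki; case: (leqP k j) => kj /= pi pj.
all: by case: ifP => /=; lia.
Qed.

Lemma res_lo_self i k : res_lo m (i%:Z - k%:Z) = (pos k (Some i))%:Z.
Proof. by rewrite (res_lo_pos i k k) pos_self leq0n subr0. Qed.

(** As this residue lies between 1 and [m], place 0 gives [m] and the formula needs no case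
    distinction. *)
Lemma res_up_self i k :
  res_up m (k%:Z - i%:Z) = m%:Z - (pos k (Some i))%:Z.
Proof.
rewrite /res_up (res_lo_pos k i k) pos_self leqn0.
have := ltn_pos k i; case: (pos k (Some i)) => [|p] pm /=.
  by lia.
by case: ifP => /eqP; lia.
Qed.

End Residues.

(** * Weights of exchange type *)

Section Weights.

Context (F : fieldType) (m : nat) (q Phi : F) (X : 'I_m -> 'I_m -> F).
Implicit Types (a b c d : spin m) (u w z : F) (k : 'I_m).

(* The arguments a, b are the two incoming spins: bottom-left and top-left for
   LL and RR, bottom-left and bottom-right for LR and RL.  In the exponents,
   the empty spin has place m, which makes [by_pos] and the powers of q uniform
   in the colours and the empty spin. *)
Definition LL_str u w a b : F :=
  match a, b with
  | None, None => u - q ^+ 2 * w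
  | Some _, None => q ^+ 2 * Phi * (u - w)
  | None, Some _ => (u - w) / Phi
  | Some i, Some j => if i == j then w - q ^+ 2 * u else X i j * (u - w)
  end.

Definition RR_str u w a b : F :=
  match a, b with
  | None, None => u - q ^+ 2 * w
  | Some _, None => (u - w) / Phi
  | None, Some _ => q ^+ 2 * Phi * (u - w)
  | Some i, Some j => if i == j then w - q ^+ 2 * u else X i j * (u - w)
  end.

Definition LR_str u w a b : F :=
  match a, b with
  | None, None => u - w
  | Some i, Some j =>
      if i == j then Phi ^+ 2 * (q ^+ 4 * w - u)
      else Phi ^+ 2 * X j i * (u - q ^+ 2 * w)
  | _, _ => Phi * (u - q ^+ 2 * w)
  end.

Definition RL_str u w a b : F :=
  match a, b with
  | None, None => w - q ^+ (2 * m) * q ^+ 2 * u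
  | Some i, Some j =>
      if i == j then (q ^+ (2 * m) / q ^+ 2 * u - w) / Phi ^+ 2
      else X j i * (w - q ^+ (2 * m) * u) / (q ^+ 2 * Phi ^+ 2)
  | _, _ => (w - q ^+ (2 * m) * u) / Phi
  end.

Definition by_pos k (x y : F) a b : F :=
  if (pos k a < pos k b)%N then x else if (pos k b < pos k a)%N then y else 0.

Definition LL_exch k u w a b := (1 - q ^+ 2) * by_pos k w u a b.
Definition RR_exch k u w a b := (1 - q ^+ 2) * by_pos k u w a b.

Definition LR_exch k u w a b : F :=
  (1 - q ^+ 2) *
  match a, b with
  | Some _, Some _ => - Phi ^+ 2 * by_pos k (q ^+ 2 * w) u a b
  | _, _ => Phi * by_pos k w u a b
  end.

Definition RL_exch k u w a b : F :=
  (1 - q ^+ 2) * q ^+ (2 * pos k a) / q ^+ (2 * pos k b) *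
  match a, b with
  | Some _, Some _ => by_pos k (q ^+ (2 * m) * u) w a b / (q ^+ 2 * Phi ^+ 2)
  | Some _, None => by_pos k (q ^+ (2 * m) * u) w a b / Phi
  | _, _ => by_pos k (q ^+ (2 * m) * u) w a b / (q ^+ 2 * Phi)
  end.

Lemma by_pos_eq k x y a : by_pos k x y a a = 0.
Proof. by rewrite /by_pos ltnn. Qed.

Lemma ifABE i j k x y : ifAB i j k x y = by_pos k x y (Some i) (Some j).
Proof. by rewrite /ifAB condAE condBE. Qed.

Lemma by_posM k x y z a b : z * by_pos k x y a b = by_pos k (z * x) (z * y) a b.
Proof. by rewrite /by_pos; do 2?case: ifP; rewrite ?mulr0. Qed.

Lemma by_pos_colour k x y i : by_pos k x y (Some i) None = x.
Proof. by rewrite /by_pos pos_empty ltn_pos. Qed.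

Lemma by_pos_empty k x y i : by_pos k x y None (Some i) = y.
Proof. by rewrite /by_pos pos_empty ltn_pos ltnNge (ltnW (ltn_pos k i)). Qed.

(** For equal incoming spins, going straight and swapping have the same outcome; with [be] zero
    there, [al] carries the whole weight and the two tests do not overlap. *)
Lemma exch_eq (al be : spin m -> spin m -> F) a b c d :
  (forall a, be a a = 0) ->
  exch al be a b c d =
    if (c == a) && (d == b) then al a b
    else if (c == b) && (d == a) then be a b else 0.
Proof.
move=> be0; rewrite /exch.
case: (eqVneq a b) => [->|ab].
  rewrite be0 !mul0r addr0.
  by case: (c == b); case: (d == b); rewrite /= ?(mulr1, mulr0).
case: (eqVneq c a) => [->|_]; rewrite ?(negbTE ab) /=.
  by case: (d == b); rewrite ?(mulr1, mulr0, mul0r, addr0).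
by case: (c == b); case: (d == a); rewrite ?(mulr1, mulr0, mul0r, add0r).
Qed.

Lemma W_LLE a b c d u w k :
  W_LL q Phi X a b c d u w k = exch (LL_str u w) (LL_exch k u w) a b c d.
Proof.
rewrite exch_eq => [|?]; last by rewrite /LL_exch by_pos_eq mulr0.
case: a b c d => [i|] [j|] [i'|] [j'|] //=; rewrite /LL_exch.
all: rewrite ?by_pos_colour ?by_pos_empty ?andbT ?andbF //.
by rewrite ifABE by_posM.
Qed.

Lemma W_RRE a b c d u w k :
  W_RR q Phi X a b c d u w k = exch (RR_str u w) (RR_exch k u w) a b c d.
Proof.
rewrite exch_eq => [|?]; last by rewrite /RR_exch by_pos_eq mulr0.
case: a b c d => [i|] [j|] [i'|] [j'|] //=; rewrite /RR_exch.
all: rewrite ?by_pos_colour ?by_pos_empty ?andbT ?andbF //.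
by rewrite ifABE by_posM.
Qed.
End Weights.

Section WeightForms.
Context (F : fieldType) (m : nat) (q Phi : F) (X : 'I_m -> 'I_m -> F).
Implicit Types (a b c d : spin m) (u w z : F) (k : 'I_m).

(** With the second line read backwards, the incoming spins are [a] and [d], and the configurations
    with equal left spins and equal right spins become swaps. *)
Lemma W_LRE a b c d u w k :
  W_LR q Phi X a b c d u w k
  = exch (LR_str q Phi X u w) (LR_exch q Phi k u w) a d c b.
Proof.
rewrite exch_eq => [|[?|]]; rewrite /LR_exch ?by_pos_eq ?mulr0 //.
case: a b c d => [i|] [j|] [i'|] [j'|] //=.
all: rewrite ?by_pos_colour ?by_pos_empty ?andbT ?andbF //=.
all: rewrite !(inj_eq Some_inj).
- rewrite [j == j']eq_sym [i' == j']eq_sym [(j' == i') && _]andbC.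
  case: ifP => [/andP[_ /eqP->] //|_].
  case: ifP => [/andP[_ /eqP->]|//].
  by rewrite ifABE !by_posM; congr by_pos; ring.
- by case: ifP => // _; ring.
- by rewrite eq_sym.
- by rewrite eq_sym; case: ifP => // _; ring.
Qed.

Lemma expfz_quo (x : int) (a b : nat) :
  q != 0 -> x = a%:Z - b%:Z -> q ^ x = q ^+ a / q ^+ b.
Proof. by move=> q0 ->; rewrite expfzDr // exprnN. Qed.

Lemma W_RLE a b c d u w k : q != 0 ->
  W_RL q Phi X a b c d u w k
  = exch (RL_str q Phi X u w) (RL_exch q Phi k u w) a d c b.
Proof.
move=> q0; rewrite exch_eq => [|[?|]].
all: rewrite /RL_exch ?by_pos_eq ?mul0r ?mulr0 //.
case: a b c d => [i|] [j|] [i'|] [j'|] //=.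
all: rewrite ?by_pos_colour ?by_pos_empty ?andbT ?andbF //=.
all: rewrite ?(inj_eq Some_inj) ?pos_empty.
- rewrite [j == j']eq_sym [i' == j']eq_sym [(j' == i') && _]andbC.
  case: ifP => [/andP[_ /eqP->]|_].
    by case: ifP => // _; rewrite (@expfz_quo _ (2 * m) 2) //; lia.
  case: ifP => [/andP[_ /eqP->]|//].
  (* If [i] comes before [i'], the residue wraps around and gains [m]: this is the factor
     [q ^+ (2 * m)] in [RL_exch]. *)
  rewrite ifABE (res_lo_pos _ _ k) /by_pos.
  case: (ltngtP (pos k (Some i)) (pos k (Some i'))) => // ii'.
  - rewrite (@expfz_quo _ (2 * pos k (Some i) + 2 * m)
               (2 * pos k (Some i') + 2)) //; last by lia.
    by rewrite !exprD !invfM; move: _^-1 => *; ring.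
  - rewrite (@expfz_quo _ (2 * pos k (Some i))
               (2 * pos k (Some i') + 2)) //; last by lia.
    by rewrite !exprD !invfM; ring.
  - by rewrite !(mulr0, mul0r).
- case: ifP => // _; rewrite res_lo_self.
  rewrite (@expfz_quo _ (2 * pos k (Some i)) 0) //; last by lia.
  rewrite expr0 divr1; move: (expf_neq0 (2 * m) q0).
  by move: (q ^+ (2 * m)) (q ^+ (2 * _)) Phi^-1 => M Q P M0; field.
- by rewrite eq_sym.
- rewrite eq_sym; case: ifP => // /eqP->; rewrite res_up_self.
  rewrite (@expfz_quo _ (2 * m) (2 * pos k (Some j') + 2)) //; last by lia.
  by rewrite !exprD !invfM; ring.
- rewrite (@expfz_quo _ (2 * m + 2) 0) //; last by lia.
  by rewrite expr0 divr1 exprD.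
Qed.
End WeightForms.

(** * Inversion of the mixed crossings *)

(** Distinct left spins must go straight through both crossings, which is the first hypothesis.
    Equal left spins [a], [a] leave as an equal pair [b], [b]; the second hypothesis collects the
    ways to do this, with a sum over the spin [y] of a closed loop when both crossings swap. *)
Lemma unitarity_rot_r (F : fieldType) (S : finType) kappa
  (al be al' be' : S -> S -> F) :
  (forall a b, a != b -> al a b * al' b a = kappa) ->
  (forall a b, al a a * (al' a a * (a == b)%:R + be' a b) + be a b * al' b b
               + \sum_y be a y * be' y b = kappa * (a == b)%:R) ->
  unitarity kappa (rot_r (exch al be)) (rot_r (exch al' be')).
Proof.
move=> Eoff Ediag a b c d; rewrite exchange_big /=.
have inner y : \sum_x rot_r (exch al be) a b x y * rot_r (exch al' be') y x c d
    = (y == b)%:R * (al a y * exch al' be' y d c a)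
      + (b == a)%:R * (be a y * exch al' be' y d c y).
  rewrite -(sum_pred1 (fun x => exch al' be' y d c x) a).
  rewrite -[X in _ + _ * (_ * X)](sum_pred1 (fun x => exch al' be' y d c x) y).
  rewrite !mulr_sumr -big_split; apply: eq_bigr => x _ /=.
  rewrite /rot_r {1}/exch [y == b]eq_sym; move: (exch _ _ _ _ _ _) => E.
  by move: (x == a)%:R (b == y)%:R (x == y)%:R (b == a)%:R => *; ring.
under eq_bigr => y _ do rewrite inner.
rewrite big_split sum_pred1 -mulr_sumr /=.
have -> : \sum_y be a y * exch al' be' y d c y
    = be a d * al' d d * (c == d)%:R + (c == d)%:R * \sum_y be a y * be' y d.
  rewrite -(sum_pred1 (fun y => be a y * al' y d * (c == y)%:R) d).
  rewrite mulr_sumr -big_split; apply: eq_bigr => y _ /=.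
  rewrite /exch eqxx mulr1.
  by move: (y == d)%:R (c == d)%:R (c == y)%:R => *; ring.
have := Ediag a d; rewrite /exch; case: (eqVneq a b) => [<-|ab] E.
  have -> : kappa * (c == a)%:R * (d == a)%:R
      = (c == d)%:R * (kappa * (a == d)%:R).
    rewrite [d == a]eq_sym.
    case: (eqVneq a d) => [->|_]; last by rewrite !mulr0.
    by rewrite !mulr1 mulrC.
  rewrite -E; case: (eqVneq a d) => [->|_]; rewrite /= ?(mulr1, mulr0).
    by move: (c == d)%:R => *; ring.
  by move: (c == d)%:R => *; ring.
rewrite mul0r mulr0 !addr0 [a == d]eq_sym.
case: (eqVneq d a) => [->|_]; last by rewrite !mulr0.
by rewrite !mulr1 mulrA Eoff.
Qed.

Lemma sum_spin (F : fieldType) m (f : spin m -> F) :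
  \sum_y f y = f None + \sum_i f (Some i).
Proof.
rewrite (bigD1 None) //=; congr (_ + _).
rewrite (reindex_omap Some id) /=; last by case.
by apply: eq_bigl => i; rewrite !eqxx.
Qed.

(** * Geometric sums over places *)

Section GeometricSums.

Context (F : fieldType) (t : F).

(** The telescoped sum of [(1 - t) * t ^+ p] over [a <= p < b], which is empty when [b < a]. *)
Definition geo (a b : nat) : F := if (a <= b)%N then t ^+ a - t ^+ b else 0.

Lemma sum_geo a b n : (b <= n)%N ->
  \sum_(p < n) (1 - t) * t ^+ p * ((a <= p) && (p < b))%N%:R = geo a b.
Proof.
elim: n b => [|n IHn] b.
  by rewrite leqn0 big_ord0 /geo => /eqP->; case: a => //=; rewrite subrr.
rewrite leq_eqVlt => /predU1P[->|bn]; rewrite big_ord_recr /=; last first.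
  by rewrite IHn // [(n < b)%N]ltnNge [(b <= n)%N]bn andbF mulr0 addr0.
transitivity (geo a n + (1 - t) * t ^+ n * (a <= n)%N%:R).
  rewrite -(IHn n) // ltnSn andbT; congr (_ + _); apply: eq_bigr => p _.
  by rewrite ltn_ord ltnS (ltnW (ltn_ord p)).
rewrite /geo [(a <= n.+1)%N]leq_eqVlt ltnS.
case: leqP => an; rewrite ?orbT ?orbF.
  by rewrite exprS mulr1; ring.
by case: eqP => [->|_]; rewrite mulr0 addr0 ?subrr.
Qed.

Definition step (A p : nat) (x y : F) : F :=
  if (A < p)%N then x else if (p < A)%N then y else 0.

(** The product of the two steps is constant on each of four ranges of [p]: between [A] and [B],
    above both, below both, and between [B] and [A]. *)
Lemma sum_step A B n x y z v : (A <= n)%N -> (B <= n)%N ->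
  \sum_(p < n) (1 - t) * t ^+ p * step A p x y * step p B z v
  = x * z * geo A.+1 B + x * v * geo (maxn A B).+1 n
    + y * z * geo 0 (minn A B) + y * v * geo B.+1 A.
Proof.
move=> An Bn.
have mn : (minn A B <= n)%N by rewrite geq_min An.
rewrite -(sum_geo _ An) -(sum_geo _ Bn) -(sum_geo _ (leqnn n)) -(sum_geo _ mn).
rewrite !mulr_sumr -!big_split; apply: eq_bigr => p _ /=.
rewrite ltn_ord gtn_max leq_min /step.
by case: (ltngtP A p) => _; case: (ltngtP p B) => _ /=; ring.
Qed.

End GeometricSums.

(** * Mixed crossings are mutually inverse *)

Section Unitarity.

Context (F : fieldType) (m : nat) (q Phi : F) (X : 'I_m -> 'I_m -> F).
Context (q0 : q != 0) (Phi0 : Phi != 0).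
Context (X_off : forall i j, i != j -> X i j * X j i = q ^+ 2).

Lemma sum_pos (k : 'I_m) (f : nat -> F) :
  \sum_i f (pos k (Some i)) = \sum_(p < m) f p.
Proof.
pose h (i : 'I_m) : 'I_m := Ordinal (ltn_pos k i).
have h_inj : injective h by move=> i j [/pos_inj []].
by rewrite [RHS](reindex_inj h_inj).
Qed.

Lemma by_posE (k : 'I_m) x y (a b : spin m) :
  by_pos k x y a b = step (pos k a) (pos k b) x y :> F.
Proof. by []. Qed.

(** The exchange weights depend on the loop colour only through its place, as a power of [t] times
    two steps, so the loop sum is an instance of [sum_step]. *)
Lemma sum_colours (k : 'I_m) u w (a b : spin m) :
  \sum_i LR_exch q Phi k u w a (Some i) * RL_exch q Phi k w u (Some i) b
  = let t := q ^+ 2 in let M := t ^+ m in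
    let A := pos k a in let B := pos k b in
    let x := if a is Some _ then t * w else w in
    (1 - t) * (if a is Some _ then - Phi ^+ 2 else Phi)
      / (t ^+ B * (if b is Some _ then t * Phi ^+ 2 else Phi))
    * (x * (M * w) * geo t A.+1 B + x * u * geo t (maxn A B).+1 m
       + u * (M * w) * geo t 0 (minn A B) + u * u * geo t B.+1 A).
Proof.
have posm c : (pos k c <= m)%N by case: c => // i; apply/ltnW/ltn_pos.
rewrite /= -sum_step // mulr_sumr.
rewrite -(sum_pos k (fun p => _ * (_ * _ p * _ p _ _ * _ p _ _ _))).
apply: eq_bigr => i _.
rewrite /LR_exch /RL_exch !by_posE !exprM /step.
have Qb0 := expf_neq0 (pos k b) (expf_neq0 2 q0).
case: a => [a|]; case: b Qb0 => [b|]; rewrite ?pos_empty => Qb0.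
all: do 4?case: ifP => // _.
all: by field; rewrite ?q0 ?Phi0.
Qed.

Lemma W_LR_RL_unitarity (k : 'I_m) u w :
  unitarity ((u - q ^+ 2 * w) * (u - q ^+ (2 * m) * w))
    (fun a b c d => W_LR q Phi X a b c d u w k)
    (fun a b c d => W_RL q Phi X a b c d w u k).
Proof.
move=> a b c d.
under eq_bigr => x _ do under eq_bigr => y _ do rewrite W_LRE W_RLE //.
move: a b c d; apply: unitarity_rot_r => a b.
  case: a b => [i|] [j|] //= ij; last 2 first.
  - by field.
  - by field.
  have {}ij : i != j by apply: contraNneq ij => ->.
  rewrite [j == i]eq_sym (negbTE ij).
  (* For distinct colours, the product of the two straight weights involves [X] only through
     [X i j * X j i], which is [q ^+ 2]. *)
  transitivity (X i j * X j i * ((u - q ^+ 2 * w) * (u - q ^+ (2 * m) * w))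
                / q ^+ 2); first by field; rewrite q0.
  by rewrite X_off // mulrC mulKf ?expf_neq0.
(* The loop is empty or coloured; the coloured part is now in closed form, and it remains to compare
   the places of [a] and [b]. *)
rewrite sum_spin sum_colours /LR_exch /RL_exch.
have Q0 p := expf_neq0 p (expf_neq0 2 q0).
case: a b => [i|] [j|]; rewrite ?(inj_eq Some_inj).
all: rewrite ?by_pos_colour ?by_pos_empty ?by_pos_eq ?pos_empty /= !exprM.
- rewrite !eqxx /by_pos /geo leq0n.
  have pi := ltn_pos k i; have pj := ltn_pos k j.
  case: (ltngtP (pos k (Some i)) (pos k (Some j))) => [ij|ij|/pos_inj[->]].
  + have /negbTE-> : i != j by apply: contraTneq ij => ->; rewrite ltnn.
    by rewrite pj /= ?(exprS (q ^+ 2)); field; rewrite q0 Phi0 Q0.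
  + have /negbTE-> : i != j by apply: contraTneq ij => ->; rewrite ltnn.
    by rewrite pi /= ?(exprS (q ^+ 2)); field; rewrite q0 Phi0 Q0.
  + by rewrite pj !eqxx /= ?(exprS (q ^+ 2)); field; rewrite q0 Phi0 Q0.
- have pi := ltn_pos k i.
  rewrite !eqxx (maxn_idPr (ltnW pi)) (minn_idPl (ltnW pi)) /geo pi ltnn leq0n.
  rewrite ltnNge (ltnW pi) /= ?(exprS (q ^+ 2)).
  by field; rewrite q0 Phi0 Q0.
- have pj := ltn_pos k j.
  rewrite !eqxx (maxn_idPl (ltnW pj)) (minn_idPr (ltnW pj)) /geo pj ltnn leq0n.
  rewrite ltnNge (ltnW pj) /= ?(exprS (q ^+ 2)).
  by field; rewrite q0 Phi0 Q0.
- rewrite maxnn minnn /geo ltnn leq0n.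
  by field; rewrite Phi0 Q0 ?q0.
Qed.

End Unitarity.

(** * Exchange kernels with a line reversed *)

Section ExchangeForms.

Context (F : fieldType) (S : finType).
Implicit Types (V U : S -> S -> S -> S -> F) (al be : S -> S -> F).

Lemma eq_ybe V12 V13 V23 V12' V13' V23' U12 U13 U23 U12' U13' U23' :
  (forall a b c d, V12 a b c d = U12 a b c d) ->
  (forall a b c d, V13 a b c d = U13 a b c d) ->
  (forall a b c d, V23 a b c d = U23 a b c d) ->
  (forall a b c d, V12' a b c d = U12' a b c d) ->
  (forall a b c d, V13' a b c d = U13' a b c d) ->
  (forall a b c d, V23' a b c d = U23' a b c d) ->
  ybe U12 U13 U23 U12' U13' U23' -> ybe V12 V13 V23 V12' V13' V23'.
Proof.
move=> E1 E2 E3 E1' E2' E3' Y a b c d e f.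
transitivity (\sum_x \sum_y \sum_h U12 a b x y * U13 x c d h * U23 y h e f).
  by do 3!apply: eq_bigr => ? _; rewrite E1 E2 E3.
by rewrite Y; do 3!apply: eq_bigr => ? _; rewrite E1' E2' E3'.
Qed.

Lemma flip_exch V al be :
  (forall a b c d, V a b c d = exch al be a b c d) ->
  forall a b c d,
    flip V a b c d = exch (fun x y => al y x) (fun x y => be y x) a b c d.
Proof.
by move=> E a b c d; rewrite /flip E /exch mulrAC [X in _ + X]mulrAC.
Qed.

Lemma rot_r_exch V al be :
  (forall a b c d, V a b c d = exch al be a d c b) ->
  forall a b c d, rot_r V a b c d = exch al be a b c d.
Proof. by move=> E a b c d; rewrite /rot_r E. Qed.

(** The arguments of [al] and [be] are now read off the outgoing side: they are [a], [b] when the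
    spins go straight and [b], [a] when they swap, so only [be] is transposed. *)
Lemma rot_l_exch V al be :
  (forall a b c d, V a b c d = exch al be a d c b) ->
  forall a b c d, rot_l V a b c d = exch al (fun x y => be y x) a b c d.
Proof.
move=> E a b c d; rewrite /rot_l E /exch; congr (_ + _).
  case: (eqVneq c a) => [->|_]; last by rewrite !(mulr0, mul0r).
  by case: (eqVneq d b) => [->|_]; last by rewrite !mulr0.
case: (eqVneq c b) => [->|_]; last by rewrite !(mulr0, mul0r).
by case: (eqVneq d a) => [->|_]; last by rewrite !(mulr0, mul0r).
Qed.

End ExchangeForms.

(** * Equations without loops *)

Section DirectCases.

Context (F : fieldType) (m : nat) (q Phi : F) (X : 'I_m -> 'I_m -> F).
Context (q0 : q != 0) (Phi0 : Phi != 0).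
Context (X_diag : forall i, X i i = - q ^+ 2).
Context (X_off : forall i j, i != j -> X i j * X j i = q ^+ 2).

Variant compare_colours (k i j : 'I_m) : bool -> bool -> bool -> bool -> Prop :=
| ColoursLt of i != j & (pos k (Some i) < pos k (Some j))%N :
    compare_colours k i j true false false false
| ColoursGt of i != j & (pos k (Some j) < pos k (Some i))%N :
    compare_colours k i j false true false false
| ColoursEq of i = j : compare_colours k i j false false true true.

Lemma colourP (k i j : 'I_m) :
  compare_colours k i j (pos k (Some i) < pos k (Some j))%N
    (pos k (Some j) < pos k (Some i))%N (i == j) (j == i).
Proof.
rewrite [j == i]eq_sym.
case: (ltngtP (pos k (Some i)) (pos k (Some j))) => [ij|ij|/pos_inj[<-]].
- have nij : i != j by apply: contraTneq ij => ->; rewrite ltnn.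
  by rewrite (negbTE nij); constructor.
- have nij : i != j by apply: contraTneq ij => ->; rewrite ltnn.
  by rewrite (negbTE nij); constructor.
- by rewrite eqxx; constructor.
Qed.

Lemma X_neq0 i j : i != j -> X i j != 0.
Proof.
move/X_off=> E; apply: contraNneq (expf_neq0 2 q0) => X0.
by rewrite -E X0 mul0r.
Qed.

Lemma X_sym i j : i != j -> X j i = q ^+ 2 / X i j.
Proof. by move=> ij; rewrite -(X_off ij) mulrAC divff ?mul1r // X_neq0. Qed.

Ltac finish_weights phi :=
  repeat match goal with H : is_true (?i != ?j) |- _ =>
    rewrite ?(X_sym H); move: (X_neq0 H) => ?; clear H end;
  repeat match goal with |- context [phi ?x ?y ?z] =>
    move: (phi x y z) => ? end;
  field; repeat (apply/andP; split); first [assumption | exact: isT].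

Ltac compare_two k i j :=
  case: (colourP k i j) => [? ?|? ?|?]; subst.

Ltac compare_three k i j l :=
  compare_two k i j; compare_two k j l; try compare_two k i l;
  try (exfalso; lia).

(** Each of the three spins is empty or a colour, and for colours only equality and relative place
    matter. In each case, once [X j i] is written as [q ^+ 2 / X i j], a rational identity in free
    variables remains. *)
Ltac ybe_cases k :=
  let i := fresh "i" in let j := fresh "j" in let l := fresh "l" in
  let phi := fresh "phi" in
  apply: exch_ybe => -[i|] [j|] [l|] phi;
  rewrite /LL_exch /RR_exch /LR_exch /= ?by_pos_colour ?by_pos_empty;
  rewrite ?by_pos_eq /by_pos ?eqxx;
  [ compare_three k i j l | compare_two k i j | compare_two k i l | idtac
  | compare_two k j l | idtac | idtac | idtac ]; finish_weights phi.

Lemma ybe_LLL (k : 'I_m) z1 z2 z3 :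
  let V u w a b c d := W_LL q Phi X a b c d u w k in
  ybe (V z1 z2) (V z1 z3) (V z2 z3) (V z1 z2) (V z1 z3) (V z2 z3).
Proof.
move=> V; apply: eq_ybe; last first; try by move=> *; apply: W_LLE.
ybe_cases k.
Qed.

Lemma ybe_RRR (k : 'I_m) z1 z2 z3 :
  let V u w a b c d := W_RR q Phi X a b c d u w k in
  ybe (V z1 z2) (V z1 z3) (V z2 z3) (V z1 z2) (V z1 z3) (V z2 z3).
Proof.
move=> V; apply: eq_ybe; last first; try by move=> *; apply: W_RRE.
ybe_cases k.
Qed.

Lemma ybe_LLR (k : 'I_m) z1 z2 z3 :
  let V u w a b c d := W_LL q Phi X a b c d u w k in
  let U u w a b c d := W_LR q Phi X a b c d u w k in
  ybe (V z1 z2) (U z1 z3) (U z2 z3) (V z1 z2) (U z1 z3) (U z2 z3).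
Proof.
move=> V U; apply: ybe_rot_r; apply: eq_ybe; last first.
all: try by [apply: flip_exch => *; apply: W_LLE
            | apply: rot_r_exch => *; apply: W_LRE].
ybe_cases k.
Qed.

Lemma ybe_LRR (k : 'I_m) z1 z2 z3 :
  let V u w a b c d := W_RR q Phi X a b c d u w k in
  let U u w a b c d := W_LR q Phi X a b c d u w k in
  ybe (U z1 z2) (U z1 z3) (V z2 z3) (U z1 z2) (U z1 z3) (V z2 z3).
Proof.
move=> V U; apply: ybe_rot_l; apply: eq_ybe; last first.
all: try by [apply: flip_exch => *; apply: W_RRE
            | apply: rot_l_exch => *; apply: W_LRE].
ybe_cases k.
Qed.

(** * Weights of the T-vertices and RTT equations without loops *)

Implicit Types (i j k : 'I_m) (a b c d : spin m) (z : F).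

(** Common to both types: [Y i] is [X i k] for [T_R], and [X k i] for [T_L], where [z] is also
    inverted. The second spin is the one on the column, and the weight is zero if its colour is not
    [k]. *)
Definition T_str (Y : 'I_m -> F) z k a b : F :=
  match a, b with
  | None, None => 1
  | Some i, None => if i == k then z else 1
  | None, Some j => if j == k then Phi else 0
  | Some i, Some j =>
      if j == k then Phi * Y i * (if i == k then z else 1) else 0
  end.

Definition TR_exch z k a b : F :=
  match a, b with
  | Some i, None => if i == k then Phi * (1 - q ^+ 2) * z else 0
  | None, Some j => if j == k then 1 else 0
  | _, _ => 0
  end.

Definition TL_exch z k a b : F :=
  match a, b with
  | Some i, None => if i == k then z^-1 else 0
  | None, Some j => if j == k then Phi * (1 - q ^+ 2) else 0
  | _, _ => 0
  end.

Lemma T_RE a b c d z k :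
  T_R q Phi X a b c d z k
  = exch (T_str (X^~ k) z k) (TR_exch z k) a b c d.
Proof.
rewrite exch_eq => [|[]] //.
case: a b c d => [i|] [j|] [i'|] [j'|] //=.
all: rewrite ?(inj_eq Some_inj) ?andbT ?andbF //.
- rewrite if_same; case: (eqVneq j k) => [->|_]; last by rewrite if_same.
  by case: (i' == i).
- by case: (eqVneq i k) => [->|_]; rewrite ?if_same.
- by case: (eqVneq j k) => [->|_]; rewrite ?if_same.
- by case: (eqVneq j k) => [->|_]; rewrite ?if_same.
Qed.

Lemma T_LE a b c d z k :
  T_L q Phi X a b c d z k
  = exch (T_str (X k) z^-1 k) (TL_exch z k) a d c b.
Proof.
rewrite exch_eq => [|[]] //.
case: a b c d => [i|] [j|] [i'|] [j'|] //=.
all: rewrite ?(inj_eq Some_inj) ?andbT ?andbF //.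
- rewrite if_same; case: (eqVneq j' k) => [->|_]; last first.
    by rewrite !andbF if_same.
  by rewrite andbT andbC.
- by case: (eqVneq i k) => [->|_]; rewrite ?if_same.
- by case: (eqVneq j' k) => [->|_]; rewrite ?andbT ?andbF ?if_same.
- by case: (eqVneq j' k) => [->|_]; rewrite ?andbT ?andbF ?if_same.
Qed.

Lemma by_pos_first k x y j : j != k -> by_pos k x y (Some k) (Some j) = x :> F.
Proof.
move=> jk; rewrite /by_pos pos_self lt0n; case: eqP => // E.
by case/eqP: jk; apply/Some_inj/(@pos_inj _ k); rewrite pos_self.
Qed.

Lemma by_pos_first_sym k x y j :
  j != k -> by_pos k x y (Some j) (Some k) = y :> F.
Proof.
move=> jk; rewrite /by_pos pos_self ltn0 lt0n; case: eqP => // E.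
by case/eqP: jk; apply/Some_inj/(@pos_inj _ k); rewrite pos_self.
Qed.

(* Passing from k to k+1 moves c_k from the first place to the last one among
   the colours. *)
Lemma by_pos_last k x y j :
  j != k -> by_pos (ordS k) x y (Some k) (Some j) = y :> F.
Proof.
move=> jk; have := ltn_pos k j; have := ltn_pos (ordS k) j.
rewrite /by_pos pos_ordS_self pos_ordS // => j1 j2.
have jgt0 : (0 < pos k (Some j))%N.
  rewrite lt0n; apply: contra_neq jk => E; apply/Some_inj/(@pos_inj _ k).
  by rewrite pos_self.
by case: ifP; [lia | case: ifP; [|lia]].
Qed.

Lemma by_pos_last_sym k x y j :
  j != k -> by_pos (ordS k) x y (Some j) (Some k) = x :> F.
Proof.
move=> jk; have := ltn_pos k j; have := ltn_pos (ordS k) j.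
rewrite /by_pos pos_ordS_self pos_ordS // => j1 j2.
have jgt0 : (0 < pos k (Some j))%N.
  rewrite lt0n; apply: contra_neq jk => E; apply/Some_inj/(@pos_inj _ k).
  by rewrite pos_self.
by case: ifP => //; lia.
Qed.

Lemma by_pos_ordS k x y i j : i != k -> j != k ->
  by_pos (ordS k) x y (Some i) (Some j) = by_pos k x y (Some i) (Some j) :> F.
Proof.
move=> ik jk; rewrite /by_pos !pos_ordS //.
have igt0 : (0 < pos k (Some i))%N.
  rewrite lt0n; apply: contra_neq ik => E; apply/Some_inj/(@pos_inj _ k).
  by rewrite pos_self.
have jgt0 : (0 < pos k (Some j))%N.
  rewrite lt0n; apply: contra_neq jk => E; apply/Some_inj/(@pos_inj _ k).
  by rewrite pos_self.
by case: (ltngtP (pos k _)); case: (ltngtP (pos k _).-1) => //; lia.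
Qed.

Ltac not_first k i := try (case: (eqVneq i k) => [->|?]).

Ltac finish_rtt k phi :=
  rewrite ?by_pos_eq;
  rewrite ?(by_pos_first, by_pos_first_sym, by_pos_last, by_pos_last_sym) //;
  rewrite ?by_pos_ordS //;
  try match goal with |- context [by_pos k _ _ (Some ?i) (Some ?j)] =>
    rewrite /by_pos; compare_two k i j end;
  rewrite ?eqxx ?X_diag;
  repeat match goal with H : is_true (?i != ?j) |- _ =>
    rewrite ?[j == i]eq_sym ?(negbTE H) ?(X_sym H);
    move: (X_neq0 H) => ?; clear H end;
  repeat match goal with |- context [phi ?x ?y ?z] =>
    move: (phi x y z) => ? end;
  field; repeat (apply/andP; split); first [assumption | exact: isT].

Ltac unfold_rtt :=
  rewrite /LL_exch /RR_exch /LR_exch /TR_exch /TL_exch /=;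
  rewrite ?by_pos_colour ?by_pos_empty ?by_pos_eq.

Ltac absent := by rewrite !(mul0r, mulr0, addr0).

Lemma ybe_RR_T k z1 z2 :
  let V k a b c d := W_RR q Phi X a b c d z1 z2 k in
  let U z a b c d := T_R q Phi X a b c d z k in
  ybe (V k) (U z1) (U z2) (V (ordS k)) (U z1) (U z2).
Proof.
move=> V U; apply: eq_ybe; last first; try (by move=> *; apply: T_RE);
  try (by move=> *; apply: W_RRE).
apply: exch_ybe => -[i|] [j|] [l|] phi; unfold_rtt.
(* [l] enters the column: if its colour is not [k], every term contains a vanishing T-weight. *)
all: try (case: (eqVneq l k) => [->|_]; last absent).
all: not_first k i; not_first k j.
all: finish_rtt k phi.
Qed.

Lemma ybe_LL_T k z1 z2 : z1 != 0 -> z2 != 0 ->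
  let V k a b c d := W_LL q Phi X a b c d z1 z2 k in
  let U z a b c d := T_L q Phi X a b c d z k in
  ybe (V k) (U z1) (U z2) (V (ordS k)) (U z1) (U z2).
Proof.
(* The column is read backwards. *)
move=> ? ? V U; apply: ybe_rot_r; apply: eq_ybe; last first.
all: try by [apply: flip_exch => *; apply: W_LLE
            | apply: rot_r_exch => *; apply: T_LE].
apply: exch_ybe => -[i|] [j|] [l|] phi; unfold_rtt.
all: try (case: (eqVneq l k) => [->|_]; last absent).
all: not_first k i; not_first k j.
all: finish_rtt k phi.
Qed.

Lemma ybe_LR_T k z1 z2 : z1 != 0 ->
  let V k a b c d := W_LR q Phi X a b c d z1 z2 k in
  ybe (V k) (fun a b c d => T_L q Phi X a b c d z1 k)
            (fun a b c d => T_R q Phi X a b c d z2 k)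
      (V (ordS k)) (fun a b c d => T_L q Phi X a b c d z1 k)
            (fun a b c d => T_R q Phi X a b c d z2 k).
Proof.
move=> ? V; apply: ybe_rot_l; apply: eq_ybe; last first.
all: try by [apply: flip_exch => *; apply: T_RE
            | apply: rot_l_exch => *; apply: W_LRE
            | apply: rot_l_exch => *; apply: T_LE].
apply: exch_ybe => -[i|] [j|] [l|] phi; unfold_rtt.
(* After the reversal of row 1 the column is the second line, so [j] is its incoming spin. *)
all: try (case: (eqVneq j k) => [->|_]; last absent).
all: not_first k i; not_first k l.
all: finish_rtt k phi.
Qed.

End DirectCases.

(** * Equations with loops *)

Section LoopCases.

Context (F : fieldType) (m : nat) (q Phi : F) (X : 'I_m -> 'I_m -> F).
Context (q0 : q != 0) (Phi0 : Phi != 0).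
Context (X_diag : forall i, X i i = - q ^+ 2).
Context (X_off : forall i j, i != j -> X i j * X j i = q ^+ 2).
Implicit Types (k : 'I_m) (u w z : F).

Let kappa u w := (u - q ^+ 2 * w) * (u - q ^+ (2 * m) * w).
Let V t s u w k (a b c d : spin m) := W q Phi X t s a b c d u w k.
Let U t z k (a b c d : spin m) := T q Phi X t a b c d z k.

Let LR_RL u w k : unitarity (kappa u w) (V L R u w k) (V R L w u k).
Proof. exact: W_LR_RL_unitarity. Qed.

Let RL_LR u w k :
  kappa u w != 0 -> unitarity (kappa u w) (V R L w u k) (V L R u w k).
Proof. by move=> uw; apply/unitarity_sym/LR_RL. Qed.

Definition rrr_equation k z1 z2 z3 tX tY tZ :=
  ybe (V tX tY z1 z2 k) (V tX tZ z1 z3 k) (V tY tZ z2 z3 k)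
      (V tX tY z1 z2 k) (V tX tZ z1 z3 k) (V tY tZ z2 z3 k).

(** Interchanging neighbouring lines of different types leads from LLR to LRL to RLL, and from LRR
    to RLR to RRL. The parameters are permuted along, and each interchange needs one nonzero
    [kappa]. *)
Lemma ybe_LRL k z1 z2 z3 : kappa z3 z2 != 0 -> rrr_equation k z1 z2 z3 L R L.
Proof.
move=> K; apply: (ybe_swap23 K (LR_RL _ _ k) (RL_LR k K)).
exact: (ybe_LLR q0 Phi0 X_off).
Qed.

Lemma ybe_RLR k z1 z2 z3 : kappa z2 z1 != 0 -> rrr_equation k z1 z2 z3 R L R.
Proof.
move=> K; apply: (ybe_swap12 K (RL_LR k K) (LR_RL _ _ k)).
exact: (ybe_LRR q0 Phi0 X_off).
Qed.

Lemma ybe_RLL k z1 z2 z3 :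
  kappa z2 z1 != 0 -> kappa z3 z1 != 0 -> rrr_equation k z1 z2 z3 R L L.
Proof.
move=> K K'; apply: (ybe_swap12 K (RL_LR k K) (LR_RL _ _ k)).
exact: ybe_LRL.
Qed.

Lemma ybe_RRL k z1 z2 z3 :
  kappa z3 z1 != 0 -> kappa z3 z2 != 0 -> rrr_equation k z1 z2 z3 R R L.
Proof.
move=> K K'; apply: (ybe_swap23 K' (LR_RL _ _ k) (RL_LR k K')).
exact: ybe_RLR.
Qed.

Lemma ybe_W k z1 z2 z3 tX tY tZ :
  kappa z2 z1 != 0 -> kappa z3 z1 != 0 -> kappa z3 z2 != 0 ->
  rrr_equation k z1 z2 z3 tX tY tZ.
Proof.
move=> K21 K31 K32; case: tX tY tZ => [] [] [].
- exact: (ybe_LLL q0 Phi0 X_off).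
- exact: (ybe_LLR q0 Phi0 X_off).
- exact: ybe_LRL.
- exact: (ybe_LRR q0 Phi0 X_off).
- exact: ybe_RLL.
- exact: ybe_RLR.
- exact: ybe_RRL.
- exact: (ybe_RRR q0 Phi0 X_off).
Qed.

Lemma ybe_T k z1 z2 tX tY : z1 != 0 -> z2 != 0 -> kappa z2 z1 != 0 ->
  ybe (V tX tY z1 z2 k) (U tX z1 k) (U tY z2 k)
      (V tX tY z1 z2 (ordS k)) (U tX z1 k) (U tY z2 k).
Proof.
move=> z10 z20 K; case: tX tY => [] [].
- exact: (ybe_LL_T q0 Phi0 X_diag X_off).
- exact: (ybe_LR_T q0 Phi0 X_diag X_off).
(* The crossings on the two sides of the column have colours [k] and [ordS k], so unitarity is used
   at both. *)
- apply: (ybe_swap12 K (RL_LR k K) (LR_RL _ _ (ordS k))).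
  exact: (ybe_LR_T q0 Phi0 X_diag X_off).
- exact: (ybe_RR_T q0 Phi0 X_diag X_off).
Qed.

(** On both sides of RTT, [h] is the bottom spin of a T-vertex; hence it may range over all spins,
    as in [ybe]. *)
Lemma T_bottom t (a b c d : spin m) z k :
  ~~ vertical k d -> T q Phi X t a b c d z k = 0.
Proof.
case: d => [l|] //; rewrite /vertical (inj_eq Some_inj) => /negbTE /= lk.
by case: t a b c => [] [i|] [j|] [l'|] //=; rewrite ?lk ?andbF.
Qed.

Lemma sum_vertical k (f : spin m -> F) :
  (forall h, ~~ vertical k h -> f h = 0) ->
  \sum_(h | vertical k h) f h = \sum_h f h.
Proof.
by move=> f0; rewrite [RHS](bigID (vertical k)) /= [X in _ + X]big1 ?addr0.
Qed.

End LoopCases.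

(** One nonzero value at a convenient point [x] shows that the polynomial is nonzero, and
    independence then excludes a zero at [v]. *)
Lemma alg_independent_neq0 (F : fieldType) n (v : n.-tuple F)
  (p : {mpoly int[n]}) (x : 'I_n -> F) :
  alg_independent v -> (map_mpoly intr p).@[x] != 0 ->
  (map_mpoly intr p).@[tnth v] != 0.
Proof. by move=> v_ind; apply: contraNneq => /v_ind->; rewrite meval0. Qed.

Lemma alg_independent_tnth_neq0 (F : fieldType) n (v : n.-tuple F) i :
  alg_independent v -> tnth v i != 0.
Proof.
move=> v_ind; have := @alg_independent_neq0 _ _ v 'X_i (fun=> 1) v_ind.
by rewrite map_mpolyX !mevalXU; apply; rewrite oner_neq0.
Qed.

Lemma alg_independent_sub_neq0 (F : fieldType) n (v : n.-tuple F) i j l e :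
  alg_independent v -> i != j -> tnth v i - tnth v l ^+ e * tnth v j != 0.
Proof.
(* At the point with coordinate 1 at [i] and 0 elsewhere, the value is 1 because [j] differs from
   [i]. *)
move=> v_ind ij; have := @alg_independent_neq0 _ _ v
  ('X_i - 'X_l ^+ e * 'X_j) (fun h => (h == i)%:R) v_ind.
rewrite rmorphB rmorphM rmorphXn /= !map_mpolyX.
rewrite !mevalB !mevalM !rmorphXn /= !mevalXU eqxx [j == i]eq_sym (negbTE ij).
by rewrite mulr0 subr0; apply; rewrite oner_neq0.
Qed.
Theorem theorem3p1 (m : nat) (m_ge1 : (1 <= m)%N) (F : fieldType)
  (q Phi z1 z2 z3 : F) (X : 'I_m -> 'I_m -> F)
  (indep : alg_independent [tuple q; Phi; z1; z2; z3])
  (X_diag : forall i, X i i = - q ^+ 2)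
  (X_off : forall i j, i != j -> X i j * X j i = q ^+ 2)
  (k : 'I_m) (tX tY tZ : rowtype) :
  (forall (a b d e c f : spin m), vertical k c -> vertical k f ->
     \sum_(x : spin m) \sum_(y : spin m) \sum_(h : spin m | vertical k h)
        W q Phi X tX tY a b x y z1 z2 k
        * T q Phi X tX x c d h z1 k
        * T q Phi X tY y h e f z2 k
     = \sum_(x : spin m) \sum_(y : spin m) \sum_(h : spin m | vertical k h)
        T q Phi X tY b c x h z2 k
        * T q Phi X tX a h y f z1 k
        * W q Phi X tX tY y x d e z1 z2 (ordS k))
  /\
  (forall (a b c d e f : spin m),
     \sum_(x : spin m) \sum_(y : spin m) \sum_(h : spin m)
        W q Phi X tX tY a b x y z1 z2 k
        * W q Phi X tX tZ x c d h z1 z3 k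
        * W q Phi X tY tZ y h e f z2 z3 k
     = \sum_(x : spin m) \sum_(y : spin m) \sum_(h : spin m)
        W q Phi X tY tZ b c x h z2 z3 k
        * W q Phi X tX tZ a h y f z1 z3 k
        * W q Phi X tX tY y x d e z1 z2 k).
Proof.
pose v := [tuple q; Phi; z1; z2; z3].
have [q0 Phi0 z10 z20] : [/\ q != 0, Phi != 0, z1 != 0 & z2 != 0].
  by split; [have := alg_independent_tnth_neq0 (inord 0) indep
    | have := alg_independent_tnth_neq0 (inord 1) indep
    | have := alg_independent_tnth_neq0 (inord 2) indep
    | have := alg_independent_tnth_neq0 (inord 3) indep];
    rewrite (tnth_nth 0) inordK.
(* These products are the scalars of the inversions; [z1], [z2], [z3] have indices 2, 3, 4 in
   [v]. *)
have K (i j : 'I_5) : i != j ->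
    (v`_i - q ^+ 2 * v`_j) * (v`_i - q ^+ (2 * m) * v`_j) != 0.
  move=> ij; have N e := alg_independent_sub_neq0 (inord 0) e indep ij.
  have := mulf_neq0 (N 2) (N (2 * m)%N).
  by rewrite !(tnth_nth 0) inordK.
have K21 := K (inord 3) (inord 2); have K31 := K (inord 4) (inord 2).
have K32 := K (inord 4) (inord 3); move: K21 K31 K32.
rewrite -!(inj_eq val_inj) /= !inordK //=.
move=> /(_ isT) K21 /(_ isT) K31 /(_ isT) K32.
split=> [a b d e c f _ _|]; last exact: ybe_W.
transitivity (\sum_x \sum_y \sum_h W q Phi X tX tY a b x y z1 z2 k
  * T q Phi X tX x c d h z1 k * T q Phi X tY y h e f z2 k).
  do 2!apply: eq_bigr => ? _; apply: sum_vertical => h /T_bottom h0.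
  by rewrite h0 mulr0 mul0r.
rewrite [LHS](ybe_T q0 Phi0 X_diag X_off _ _ _ z10 z20 K21).
do 2!apply: eq_bigr => ? _; apply/esym/sum_vertical => h /T_bottom h0.
by rewrite h0 !mul0r.
Qed.
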